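(* Let $(E,C)$ be a separated graph without isolated vertices. Then the space $\mathfrak U$ of ultrafilters on the semilattice of idempotents of $\mathcal S(E,C)$ is closed in the space of all filters if and only if $(E,C)$ is finitely separated, that is, all elements of the partition $C$ are finite sets.
   Context: A directed graph $E=(E^0,E^1,s,r)$ consists of sets $E^0$, $E^1$ (arbitrary cardinality) and maps $s,r\colon E^1\to E^0$. A separated graph $(E,C)$ is a directed graph with $C=\bigsqcup_{v}C_v$, where $C_v$ is a partition of $s^{-1}(v)$ into pairwise disjoint nonempty subsets ($C_v=\emptyset$ if $s^{-1}(v)=\emptyset$). A vertex $v$ is isolated if $s^{-1}(v)=r^{-1}(v)=\emptyset$. $E^{-1}=\{e^{-1}:e\in E^1\}$ is a set of formal inverses, $\hat E^1=E^1\sqcup E^{-1}$, $s(e^{-1})=r(e)$, $r(e^{-1})=s(e)$. $\mathcal S(E,C)$ is the universal inverse semigroup with zero generated by $E^0\cup\hat E^1$ subject to: (1) $vw=\delta_{v,w}v$ for $v,w\in E^0$; (2) $s(x)x=x$ and (3) $xr(x)=x$ for $x\in\hat E^1$; (4) $e^{-1}f=\delta_{e,f}r(e)$ for $e,f\in X$, $X\in C$. For a semilattice $\mathcal E$ with zero, a filter is a nonempty subset $\xi\subseteq\mathcal E\setminus\{0\}$ that is upward closed and closed under products; an ultrafilter is a maximal filter. The space of filters has the topology inherited from $\{0,1\}^{\mathcal E}$ (product topology) via characteristic functions. *)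

(* Defs.v *)
From HB Require Import structures.
From mathcomp Require Import all_boot all_order generic_quotient.
From mathcomp Require Import all_classical topology.

Set Implicit Arguments.
Unset Strict Implicit.
Unset Printing Implicit Defensive.

Import Order.TTheory.
Local Open Scope classical_set_scope.
Local Open Scope quotient_scope.
Local Open Scope group_scope.

HB.mixin Record Semigroup_isInverse0 S of Semigroup S := {
  szero : S;
  sinv : S -> S;
  mul0s : left_zero szero (@mul S);
  muls0 : right_zero szero (@mul S);
  mulsVs : forall x : S, x * sinv x * x = x;
  mulVsV : forall x : S, sinv x * x * sinv x = sinv x;
  sinv_unique : forall x y : S, x * y * x = x -> y * x * y = y -> y = sinv x
}.

#[short(type="inverseSemigroup0Type")]
HB.structure Definition InverseSemigroup0 :=
  {S of Semigroup_isInverse0 S & Semigroup S}.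

Definition inverse_semigroup0_hom (S T : inverseSemigroup0Type) (f : S -> T) :=
  (forall x y, f (x * y) = f x * f y) /\ f szero = szero.

Definition idempotents (S : inverseSemigroup0Type) := {x : S | x * x == x}.

Section Idempotents.
Variable S : inverseSemigroup0Type.
Implicit Types x y : S.

HB.instance Definition _ := SubChoice.on (idempotents S).

Lemma idem_mulss (e : idempotents S) : val e * val e = val e.
Proof. by case: e => x /= /eqP. Qed.

Lemma idem_sinv x : x * x = x -> sinv x = x.
Proof. by move=> xx; apply/esym/sinv_unique; rewrite !xx. Qed.

Lemma idem_mul x y : x * x = x -> y * y = y -> (x * y) * (x * y) = x * y.
Proof.
move=> xx yy; set z := sinv (x * y).
have z1 : x * y * z * (x * y) = x * y by exact: mulsVs.
have z2 : z * (x * y) * z = z by exact: mulVsV.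
have tz : y * z * x = z.
  apply: sinv_unique.
    by rewrite -[RHS]z1 !mulgA -(mulgA x y y) yy -(mulgA _ x x) xx.
  rewrite -{3}z2 !mulgA -(mulgA _ x x) xx -(mulgA _ y y) yy.
  by rewrite -!mulgA.
have zz : z * z = z.
  by rewrite -{1 2}tz -{3}tz -{3}z2 !mulgA.
by have := idem_sinv zz => zE; rewrite (_ : x * y = z) // -zE; exact: sinv_unique.
Qed.

Lemma idem_comm x y : x * x = x -> y * y = y -> x * y = y * x.
Proof.
move=> xx yy.
have xy := idem_mul xx yy; have yx := idem_mul yy xx.
rewrite -{1}(idem_sinv xy); apply/esym/sinv_unique.
  by rewrite !mulgA -(mulgA x y y) yy -(mulgA _ x x) xx -mulgA xy.
by rewrite !mulgA -(mulgA y x x) xx -(mulgA _ y y) yy -mulgA yx.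
Qed.

Lemma idem_meet_subproof (e f : idempotents S) :
  (val e * val f) * (val e * val f)
    == val e * val f.
Proof. by apply/eqP/idem_mul; exact: idem_mulss. Qed.

Definition idem_meet e f : idempotents S :=
  exist _ (val e * val f) (idem_meet_subproof e f).

Definition idem_le (e f : idempotents S) := idem_meet e f == e.

Lemma idem_bot_subproof : @szero S * szero == szero.
Proof. by rewrite mul0s. Qed.

Definition idem_bot : idempotents S := exist _ szero idem_bot_subproof.

Lemma idem_meetC : commutative idem_meet.
Proof. by move=> e f; apply/val_inj/idem_comm; exact: idem_mulss. Qed.

Lemma idem_meetA : associative idem_meet.
Proof. by move=> e f g; apply/val_inj; exact: mulgA. Qed.

Lemma idem_meetxx : idempotent_op idem_meet.
Proof. by move=> e; apply/val_inj; exact: idem_mulss. Qed.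

Lemma idem_le_refl : reflexive idem_le.
Proof. by move=> e; rewrite /idem_le idem_meetxx. Qed.

Lemma idem_le_anti : antisymmetric idem_le.
Proof. by move=> e f /andP[/eqP ef /eqP fe]; rewrite -ef idem_meetC. Qed.

Lemma idem_le_trans : transitive idem_le.
Proof.
move=> f e g /eqP ef /eqP fg; apply/eqP.
by rewrite -ef -idem_meetA fg.
Qed.

Fact idem_display : Order.disp_t. Proof. exact: Order.Disp tt tt. Qed.

HB.instance Definition _ := Order.Le_isPOrder.Build idem_display
  (idempotents S) idem_le_refl idem_le_anti idem_le_trans.
HB.instance Definition _ := Order.POrder_Meet_isSemilattice.Build idem_display
  (idempotents S) idem_meetC idem_meetA (fun _ _ => erefl).

Lemma idem_le0x (e : idempotents S) : (idem_bot <= e)%O.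
Proof. by rewrite leEmeet; apply/eqP/val_inj; exact: mul0s. Qed.

HB.instance Definition _ :=
  Order.hasBottom.Build idem_display (idempotents S) idem_le0x.

End Idempotents.

Inductive word (G : Type) : Type :=
| WGen of G
| WZero
| WMul of word G & word G
| WInv of word G.

Arguments WZero {G}.

HB.instance Definition _ (G : Type) := gen_eqMixin (word G).
HB.instance Definition _ (G : Type) := gen_choiceMixin (word G).

(* The least congruence containing R whose quotient is an inverse semigroup
   with zero; pres_univ below is the corresponding universal property. *)
Inductive pres_cong (G : Type) (R : word G -> word G -> Prop) :
  word G -> word G -> Prop :=
| pc_rel u v : R u v -> pres_cong R u v
| pc_refl u : pres_cong R u u
| pc_sym u v : pres_cong R u v -> pres_cong R v u
| pc_trans u v w : pres_cong R u v -> pres_cong R v w -> pres_cong R u w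
| pc_mul u u' v v' : pres_cong R u u' -> pres_cong R v v' ->
    pres_cong R (WMul u v) (WMul u' v')
| pc_inv u u' : pres_cong R u u' -> pres_cong R (WInv u) (WInv u')
| pc_assoc u v w : pres_cong R (WMul u (WMul v w)) (WMul (WMul u v) w)
| pc_mul0 u : pres_cong R (WMul WZero u) WZero
| pc_mulr0 u : pres_cong R (WMul u WZero) WZero
| pc_mulV u : pres_cong R (WMul (WMul u (WInv u)) u) u
| pc_Vmul u : pres_cong R (WMul (WMul (WInv u) u) (WInv u)) (WInv u)
| pc_Vuniq u v : pres_cong R (WMul (WMul u v) u) u ->
    pres_cong R (WMul (WMul v u) v) v -> pres_cong R v (WInv u).

Section Presentation.
Variables (G : Type) (R : word G -> word G -> Prop).
Implicit Types u v w : word G.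

Definition pres_congb : rel (word G) := fun u v => `[< pres_cong R u v >].

Lemma pres_congb_refl : reflexive pres_congb.
Proof. by move=> u; apply/asboolP; exact: pc_refl. Qed.

Lemma pres_congb_sym : symmetric pres_congb.
Proof. by move=> u v; apply/asbool_equiv_eq; split; exact: pc_sym. Qed.

Lemma pres_congb_trans : transitive pres_congb.
Proof.
by move=> v u w /asboolP uv /asboolP vw; apply/asboolP; exact: pc_trans uv vw.
Qed.

Canonical pres_equiv :=
  EquivRel pres_congb pres_congb_refl pres_congb_sym pres_congb_trans.

Definition presented := {eq_quot pres_equiv}.

HB.instance Definition _ := Choice.on presented.
HB.instance Definition _ := EqQuotient.on presented.

Definition pres_pi (u : word G) : presented := \pi_presented u.

Lemma pres_piP u v : pres_pi u = pres_pi v <-> pres_cong R u v.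
Proof.
by split=> [/eqmodP/asboolP|uv]; [|apply/eqmodP/asboolP].
Qed.

Lemma pres_reprK (a : presented) : pres_pi (repr a) = a.
Proof. exact: reprK. Qed.

Definition pres_mul (a b : presented) := pres_pi (WMul (repr a) (repr b)).
Definition pres_inv (a : presented) := pres_pi (WInv (repr a)).

Lemma pres_mulE u v : pres_mul (pres_pi u) (pres_pi v) = pres_pi (WMul u v).
Proof. by apply/pres_piP/pc_mul; apply/pres_piP/pres_reprK. Qed.

Lemma pres_invE u : pres_inv (pres_pi u) = pres_pi (WInv u).
Proof. by apply/pres_piP/pc_inv/pres_piP/pres_reprK. Qed.

Lemma pres_mulA : associative pres_mul.
Proof.
move=> a b c; rewrite -(pres_reprK a) -(pres_reprK b) -(pres_reprK c).
by rewrite !pres_mulE; apply/pres_piP; exact: pc_assoc.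
Qed.

HB.instance Definition _ := isSemigroup.Build presented pres_mulA.

Lemma pres_mul0 : left_zero (pres_pi WZero) pres_mul.
Proof.
move=> a; rewrite -(pres_reprK a) pres_mulE; apply/pres_piP; exact: pc_mul0.
Qed.

Lemma pres_mulr0 : right_zero (pres_pi WZero) pres_mul.
Proof.
move=> a; rewrite -(pres_reprK a) pres_mulE; apply/pres_piP; exact: pc_mulr0.
Qed.

Lemma pres_mulV (a : presented) : pres_mul (pres_mul a (pres_inv a)) a = a.
Proof.
rewrite -(pres_reprK a) pres_invE !pres_mulE; apply/pres_piP; exact: pc_mulV.
Qed.

Lemma pres_Vmul (a : presented) :
  pres_mul (pres_mul (pres_inv a) a) (pres_inv a) = pres_inv a.
Proof.
rewrite -(pres_reprK a) pres_invE !pres_mulE; apply/pres_piP; exact: pc_Vmul.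
Qed.

Lemma pres_Vuniq (a b : presented) : pres_mul (pres_mul a b) a = a ->
  pres_mul (pres_mul b a) b = b -> b = pres_inv a.
Proof.
rewrite -(pres_reprK a) -(pres_reprK b) pres_invE !pres_mulE.
by move=> /pres_piP ab /pres_piP ba; apply/pres_piP; exact: pc_Vuniq.
Qed.

HB.instance Definition _ := Semigroup_isInverse0.Build presented
  pres_mul0 pres_mulr0 pres_mulV pres_Vmul pres_Vuniq.

Definition pres_gen (g : G) : presented := pres_pi (WGen g).

End Presentation.

Fixpoint weval (G : Type) (T : inverseSemigroup0Type) (f : G -> T)
    (u : word G) : T :=
  match u with
  | WGen g => f g
  | WZero => szero
  | WMul v w => weval f v * weval f w
  | WInv v => sinv (weval f v)
  end.

Lemma pres_relP (G : Type) (R : word G -> word G -> Prop) (u v : word G) :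
  R u v -> weval (@pres_gen G R) u = weval (@pres_gen G R) v.
Proof.
move=> Ruv; have E w : weval (@pres_gen G R) w = pres_pi R w.
  elim: w => [//|//|w IHw w' IHw'|w IHw] /=.
    by rewrite IHw IHw'; exact: pres_mulE.
  by rewrite IHw; exact: pres_invE.
by rewrite !E; apply/pres_piP/pc_rel.
Qed.

Lemma pres_univ (G : Type) (R : word G -> word G -> Prop)
    (T : inverseSemigroup0Type) (f : G -> T) :
  (forall u v, R u v -> weval f u = weval f v) ->
  exists! phi : presented R -> T,
    inverse_semigroup0_hom phi /\ forall g, phi (pres_gen R g) = f g.
Proof.
move=> fR.
have fC u v : pres_cong R u v -> weval f u = weval f v.
  elim=> /= [u' v' /fR//|//|//|u1 v1 w1 _ -> _ -> //|u1 u2 v1 v2 _ -> _ -> //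
    |u1 u2 _ -> //|u1 v1 w1|u1|u1|u1|u1|u1 v1 _ h1 _ h2].
  - exact: mulgA.
  - exact: mul0s.
  - exact: muls0.
  - exact: mulsVs.
  - exact: mulVsV.
  - exact: sinv_unique.
have fE u : weval f (repr (pres_pi R u)) = weval f u.
  by apply/fC/pres_piP/pres_reprK.
exists (fun a => weval f (repr a)); split.
  split; last by move=> g; rewrite [LHS]fE.
  by split=> [a b|]; [rewrite [LHS]fE|rewrite [LHS]fE].
move=> psi [[psiM psi0] psig]; apply/funext => a.
rewrite -{2}(pres_reprK a).
elim: (repr a) => [g|/=|u IHu v IHv|u IHu] /=.
- by rewrite psig.
- by rewrite -psi0.
- by rewrite IHu IHv -psiM; congr psi; exact: pres_mulE.
- rewrite -pres_invE; apply/esym; rewrite IHu; apply: sinv_unique.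
    by rewrite -!psiM; congr psi; exact: mulsVs.
  by rewrite -!psiM; congr psi; exact: mulVsV.
Qed.

Record directed_graph := DirectedGraph {
  vertex : Type;
  edge : Type;
  src : edge -> vertex;
  rng : edge -> vertex }.

Record separated_graph := SeparatedGraph {
  sg_graph :> directed_graph;
  sep : vertex sg_graph -> set (set (edge sg_graph));
  sep_partition : forall v, partition (sep v) id (@src sg_graph @^-1` [set v]) }.

Definition sep_all (E : separated_graph) : set (set (edge E)) :=
  \bigcup_(v in [set: vertex E]) sep v.

Arguments sep_all : clear implicits.

Definition finitely_separated (E : separated_graph) : Prop :=
  forall X, sep_all E X -> finite_set X.

Definition isolated_vertex (E : directed_graph) (v : vertex E) : Prop :=
  @src E @^-1` [set v] = set0 /\ @rng E @^-1` [set v] = set0.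

(* The double of the edge set: Fwd e is e, Bwd e is the formal inverse e^{-1}. *)
Inductive dedge (E : directed_graph) : Type :=
| Fwd of edge E
| Bwd of edge E.

Definition dsrc (E : directed_graph) (x : dedge E) : vertex E :=
  match x with Fwd e => src e | Bwd e => rng e end.

Definition drng (E : directed_graph) (x : dedge E) : vertex E :=
  match x with Fwd e => rng e | Bwd e => src e end.

Inductive sg_gen (E : directed_graph) : Type :=
| GVertex of vertex E
| GEdge of dedge E.

Definition wV (E : directed_graph) (v : vertex E) : word (sg_gen E) :=
  WGen (GVertex v).
Definition wE (E : directed_graph) (x : dedge E) : word (sg_gen E) :=
  WGen (GEdge x).

(* sg_ee, sg_src and sg_rng force the generator Bwd e to be the inverse, in the
   presented inverse semigroup, of Fwd e, so no relation with WInv is needed. *)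
Inductive sg_rel (E : separated_graph) :
  word (sg_gen E) -> word (sg_gen E) -> Prop :=
| sg_vv (v : vertex E) : sg_rel (WMul (wV v) (wV v)) (wV v)
| sg_vw (v w : vertex E) : v <> w -> sg_rel (WMul (wV v) (wV w)) WZero
| sg_src (x : dedge E) : sg_rel (WMul (wV (dsrc x)) (wE x)) (wE x)
| sg_rng (x : dedge E) : sg_rel (WMul (wE x) (wV (drng x))) (wE x)
| sg_ee (X : set (edge E)) (e : edge E) : sep_all E X -> X e ->
    sg_rel (WMul (wE (Bwd e)) (wE (Fwd e))) (wV (rng e))
| sg_ef (X : set (edge E)) (e f : edge E) : sep_all E X -> X e -> X f ->
    e <> f -> sg_rel (WMul (wE (Bwd e)) (wE (Fwd f))) WZero.

Definition sg_semigroup (E : separated_graph) : inverseSemigroup0Type :=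
  presented (@sg_rel E).

Section Filters.
Context {d : Order.disp_t} (L : bMeetSemilatticeType d).

Definition semilattice_filter (F : set L) : Prop :=
  [/\ F !=set0, ~ F \bot%O,
      (forall x y, F x -> (x <= y)%O -> F y) &
      (forall x y, F x -> F y -> F (x `&` y)%O)].

Definition semilattice_ultrafilter (F : set L) : Prop :=
  semilattice_filter F /\
  forall F', semilattice_filter F' -> F `<=` F' -> F' = F.

Definition filters : set (set L) := [set F | semilattice_filter F].

(* The space of filters carries the topology induced by the product topology
   on {0,1}^L through characteristic functions. *)
Definition filter_char (F : filters) : {ptws L -> bool} :=
  fun x => x \in set_val F.

Definition filter_space := initial_topology filter_char.

HB.instance Definition _ := Topological.on filter_space.

Definition ultrafilter_set : set filter_space :=
  [set F | semilattice_ultrafilter (set_val F)].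

End Filters.

Arguments ultrafilter_set {d} L.

(* Main.v *)
Require Import Defs.
From mathcomp Require Import all_boot all_order.
From mathcomp Require Import all_classical topology.

Set Implicit Arguments.
Unset Strict Implicit.
Unset Printing Implicit Defensive.
Import Order.TTheory.
Local Open Scope classical_set_scope.

(** Everything rests on one fact about ultrafilters of idempotents of S(E,C)
    (ultrafilter_block): if F is an ultrafilter containing t t^-1, where t ends
    at the vertex v, then for each block X of C_v some (t f)(t f)^-1 with f in X
    lies in F. In other words, an ultrafilter makes a choice in every block that
    it meets.

    If all blocks are finite, this property passes to a limit xi of
    ultrafilters, since a neighbourhood of xi can watch the finitely many
    elements (t f)(t f)^-1 with f in X at once. A filter F above such a xi must
    equal it: every idempotent is s s^-1 with s a product of generators, and one shows
    by adding generators on the right that s s^-1 in F forces s s^-1 in xi; at a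
    new edge e of a block X, xi has already chosen some f in X, and f must be e
    because the choices in one block are orthogonal
    (closure_ultrafilter_maximal).

    If some block X of C_v is infinite, pick for each edge e an ultrafilter
    containing e e^-1 and pass to the limit along a nonprincipal ultrafilter on
    X. The limit contains v but no f f^-1 with f in X, so it makes no choice in
    X and is not an ultrafilter (closed_finite_block).

    The fact itself reduces, after conjugating by t, to a statement on nonzero
    idempotents y below v (edge_meet_neq0): if y lies below no g g^-1 with g in
    X, then y f f^-1 is nonzero for all f in X.
    S(E,C) acts by partial bijections on any E-branching system, that is, on a
    set with disjoint subsets for the vertices and an injection for each edge e,
    defined on the subset at r(e), with values in the subset at s(e), such that
    edges of one block have disjoint images. So a product is nonzero as soon as it is
    somewhere defined in one such system. The nonzero elements of S(E,C) form a
    system under left multiplication, where y fixes the point y, and y lies in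
    no image of an edge of X. Add a disjoint second copy and redirect the
    injection of f there so that it sends the point r(f) to the y of the first
    copy. This is again a branching system, and both y and f f^-1 fix y in it. *)

(** * Range projections in an inverse semigroup *)

Section InverseSemigroup.
Local Open Scope group_scope.
Variable S : inverseSemigroup0Type.
Implicit Types s t : S.

Lemma sinvK : involutive (@sinv S).
Proof. by move=> s; apply/esym/sinv_unique; rewrite ?mulVsV ?mulsVs. Qed.

Lemma mulsV_idem s : s * sinv s * (s * sinv s) = s * sinv s.
Proof. by rewrite mulgA mulsVs. Qed.

Lemma mulVs_idem s : sinv s * s * (sinv s * s) = sinv s * s.
Proof. by rewrite mulgA mulVsV. Qed.

Lemma sinvM s t : sinv (s * t) = sinv t * sinv s.
Proof.
have C := idem_comm (mulVs_idem s) (mulsV_idem t).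
apply/esym/sinv_unique.
  rewrite -!mulgA (mulgA t (sinv t)) (mulgA (sinv s) s) (mulgA _ _ t).
  by rewrite -C !mulgA mulsVs -!mulgA (mulgA t) mulsVs.
rewrite -!mulgA (mulgA (sinv s) s) (mulgA t (sinv t)) (mulgA _ _ (sinv s)).
by rewrite C !mulgA mulVsV -!mulgA (mulgA (sinv s) s) mulVsV.
Qed.

Lemma sinv0 : sinv (szero : S) = szero.
Proof. by apply: idem_sinv; rewrite mul0s. Qed.

Definition rproj s : idempotents S := exist _ (s * sinv s) (introT eqP (mulsV_idem s)).

Lemma rprojV (x : idempotents S) : rproj (val x) = x.
Proof. by apply: val_inj; rewrite /= idem_sinv idem_mulss. Qed.

Lemma idem_leP (e f : idempotents S) : (e <= f)%O <-> val e * val f = val e.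
Proof. by rewrite leEmeet; split=> [/eqP/(congr1 val)|h] //; apply/eqP/val_inj. Qed.

Lemma rproj0 s : rproj s = \bot%O <-> s = szero.
Proof.
split=> [/(congr1 val) /= h|->]; first by rewrite -(mulsVs s) h mul0s.
by apply: val_inj; rewrite /= mul0s.
Qed.

Lemma rproj_mul_le s t : (rproj (s * t) <= rproj s)%O.
Proof.
apply/idem_leP => /=; rewrite sinvM -!mulgA; congr (_ * _).
by rewrite (mulgA (sinv s)) mulVsV.
Qed.
End InverseSemigroup.

(** * Generators of the inverse semigroup of a separated graph *)

Section Generators.
Local Open Scope group_scope.
Variable E : separated_graph.

Definition vgen (v : vertex E) : sg_semigroup E := pres_gen (@sg_rel E) (GVertex v).
Definition egen (x : dedge E) : sg_semigroup E := pres_gen (@sg_rel E) (GEdge x).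

Lemma sep_src v (X : set (edge E)) e : sep v X -> X e -> src e = v.
Proof.
move=> vX Xe; have [cov _ _] := sep_partition v.
have : cover (sep v) id e by exists X.
by rewrite cov.
Qed.

Lemma sep_block (e : edge E) : exists2 X, sep (src e) X & X e.
Proof.
have [cov _ _] := sep_partition (src e).
have : (@src E @^-1` [set src e]) e by [].
by rewrite -cov => -[X eX Xe]; exists X.
Qed.

(** Blocks at one vertex are disjoint, and a block determines its vertex as the
    source of its edges; so an edge lies in a single block of the whole of C. *)
Lemma sep_all_eq (X Y : set (edge E)) e :
  sep_all E X -> sep_all E Y -> X e -> Y e -> X = Y.
Proof.
move=> [v _ vX] [w _ wY] Xe Ye.
have [_ triv _] := sep_partition v; apply: triv => //; last by exists e.
by rewrite -(sep_src vX Xe) (sep_src wY Ye).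
Qed.

Lemma vgen_idem v : vgen v * vgen v = vgen v.
Proof. exact: (pres_relP (sg_vv v)). Qed.

Lemma vgen_mul0 v w : v <> w -> vgen v * vgen w = szero.
Proof. by move=> vw; exact: (pres_relP (sg_vw vw)). Qed.

Lemma egen_src x : vgen (dsrc x) * egen x = egen x.
Proof. exact: (pres_relP (sg_src x)). Qed.

Lemma egen_rng x : egen x * vgen (drng x) = egen x.
Proof. exact: (pres_relP (sg_rng x)). Qed.

Lemma egenVe (e : edge E) : egen (Bwd e) * egen (Fwd e) = vgen (rng e).
Proof.
by have [X eX Xe] := sep_block e; apply: (pres_relP (sg_ee _ Xe)); exists (src e).
Qed.

Lemma egen_ef X (e f : edge E) : sep_all E X -> X e -> X f -> e <> f ->
  egen (Bwd e) * egen (Fwd f) = szero.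
Proof. by move=> EX Xe Xf ef; exact: (pres_relP (sg_ef EX Xe Xf ef)). Qed.

Lemma sinv_Fwd (e : edge E) : sinv (egen (Fwd e)) = egen (Bwd e).
Proof.
apply/esym/sinv_unique; first by rewrite -mulgA egenVe (egen_rng (Fwd e)).
by rewrite egenVe (egen_src (Bwd e)).
Qed.

Lemma sinv_Bwd (e : edge E) : sinv (egen (Bwd e)) = egen (Fwd e).
Proof. by rewrite -sinv_Fwd sinvK. Qed.

Lemma sinv_vgen v : sinv (vgen v) = vgen v.
Proof. exact: idem_sinv (vgen_idem v). Qed.

Lemma fwd_meet0 X (e f : edge E) : sep_all E X -> X e -> X f -> e <> f ->
  egen (Fwd e) * egen (Bwd e) * (egen (Fwd f) * egen (Bwd f)) = szero.
Proof.
move=> EX Xe Xf ef; rewrite -mulgA (mulgA (egen (Bwd e))) (egen_ef EX Xe Xf ef).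
by rewrite mul0s muls0.
Qed.

Lemma weval_pi (u : word (sg_gen E)) :
  weval (@pres_gen _ (@sg_rel E)) u = pres_pi (@sg_rel E) u :> sg_semigroup E.
Proof.
elim: u => [//|//|u IHu v IHv|u IHu] /=; first by rewrite IHu IHv; exact: pres_mulE.
by rewrite IHu; exact: pres_invE.
Qed.

Lemma sg_word (s : sg_semigroup E) :
  exists u : word (sg_gen E), s = weval (@pres_gen _ (@sg_rel E)) u.
Proof. by exists (repr s); rewrite weval_pi pres_reprK. Qed.

(** The generators are closed under inversion, so S(E,C) is generated by them as a
    semigroup. Building products by adding one generator on the right is the
    form needed to follow a path edge by edge. *)
Inductive is_product : sg_semigroup E -> Prop :=
| is_product_0 : is_product szero
| is_product_v v : is_product (vgen v)
| is_product_vM s v : is_product s -> is_product (s * vgen v)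
| is_product_eM s x : is_product s -> is_product (s * egen x).

Lemma is_product_e x : is_product (egen x).
Proof. by rewrite -egen_src; apply/is_product_eM/is_product_v. Qed.

Lemma is_productM s t : is_product s -> is_product t -> is_product (s * t).
Proof.
move=> Ps; elim=> [|v|r v _ IH|r x _ IH]; rewrite ?mulgA ?muls0.
- exact: is_product_0.
- exact: is_product_vM.
- exact: is_product_vM.
- exact: is_product_eM.
Qed.

Lemma is_productV s : is_product s -> is_product (sinv s).
Proof.
elim=> [|v|r v _ IH|r x _ IH]; rewrite ?sinv0 ?sinvM ?sinv_vgen.
- exact: is_product_0.
- exact: is_product_v.
- by apply: is_productM => //; exact: is_product_v.
- apply: is_productM => //.
  by case: x => e; rewrite ?sinv_Fwd ?sinv_Bwd; exact: is_product_e.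
Qed.

Lemma is_productP s : is_product s.
Proof.
have [u ->] := sg_word s; elim: u => [[v|x]||u IHu v IHv|u IHu] /=.
- exact: is_product_v.
- exact: is_product_e.
- exact: is_product_0.
- exact: is_productM.
- exact: is_productV.
Qed.

(** A nonzero element behaves as a path: it has an end vertex and, by the next
    lemma, a start vertex. *)
Lemma sg_rvertex s : s <> szero -> exists v, s * vgen v = s.
Proof.
case: (is_productP s) => [//|v _|r v _ _|r x _ _].
- by exists v; exact: vgen_idem.
- by exists v; rewrite -mulgA vgen_idem.
- by exists (drng x); rewrite -mulgA egen_rng.
Qed.

Lemma sg_lvertex s : s <> szero -> exists v, vgen v * s = s.
Proof.
move=> s0; have [|v vE] := @sg_rvertex (sinv s).
  by move=> h; apply: s0; rewrite -(sinvK s) h sinv0.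
by exists v; rewrite -[in LHS](sinvK s) -(sinv_vgen v) -sinvM vE sinvK.
Qed.

End Generators.

(** * Branching systems and the action of words on them *)

Section Models.
Variable E : separated_graph.

(** [step e p q] is the graph of the injection attached to e, mapping q to p; it is
    a relation because the injection is only defined at r(e). *)
Record branching := Branching {
  point :> Type;
  at_ : vertex E -> point -> Prop;
  step : edge E -> point -> point -> Prop;
  at_uniq : forall v w p, at_ v p -> at_ w p -> v = w;
  step_at : forall e p q, step e p q -> at_ (src e) p /\ at_ (rng e) q;
  step_fun : forall e p p' q, step e p q -> step e p' q -> p = p';
  step_inj : forall e p q q', step e p q -> step e p q' -> q = q';
  step_total : forall e q, at_ (rng e) q -> exists p, step e p q;
  step_sep : forall X e f p q q', sep_all E X -> X e -> X f ->
    step e p q -> step f p q' -> e = f }.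

(** [act M u p q] means that u maps q to p; with this order of the arguments
    a product of words acts by composition, as left multiplication does. *)
Fixpoint act (M : branching) (u : word (sg_gen E)) (p q : M) : Prop :=
  match u with
  | WGen (GVertex v) => p = q /\ at_ v q
  | WGen (GEdge (Fwd e)) => step e p q
  | WGen (GEdge (Bwd e)) => step e q p
  | WZero => False
  | WMul u v => exists2 r, act u p r & act v r q
  | WInv u => act u q p
  end.

Section Soundness.
Variable M : branching.

Lemma act_partial_bij (u : word (sg_gen E)) :
  (forall p p' q : M, act u p q -> act u p' q -> p = p') /\
  (forall p q q' : M, act u p q -> act u p q' -> q = q').
Proof.
elim: u => [[v|[e|e]]||u [uf ui] v [vf vi]|u [uf ui]] //=.
- by split=> [p p' q [-> _] [-> _]|p q q' [<- _] [<- _]].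
- by split=> [p p' q|p q q']; [exact: step_fun|exact: step_inj].
- by split=> [p p' q|p q q']; [exact: step_inj|exact: step_fun].
- split=> [p p' q [r pr rq] [r' pr' rq']|p q q' [r pr rq] [r' pr' rq']].
    by move: pr'; rewrite -(vf _ _ _ rq rq'); exact: uf.
  by move: rq'; rewrite -(ui _ _ _ pr pr'); exact: vi.
- by split=> [p p' q|p q q']; [exact: ui|exact: uf].
Qed.

(** Partial bijections of a set form an inverse semigroup with zero in which the
    axioms of a branching system give the defining relations of S(E,C). The
    cases of inverses use act_partial_bij. *)
Lemma act_sound u v : pres_cong (@sg_rel E) u v ->
  forall p q : M, act u p q <-> act v p q.
Proof.
elim=> {u v} /=.
- move=> u v; case=> /= {u v}.
  + move=> v p q; split=> [[r [-> _] []]|[-> qv]] //; by exists q.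
  + by move=> v w vw p q; split=> // -[r [_ rv] [rq qw]]; apply: vw; rewrite rq in rv;
      exact: at_uniq rv qw.
  + case=> e p q /=; split=> [[r [-> _]]|pq] //; exists p => //; split=> //;
    by have [] := step_at pq.
  + case=> e p q /=; split=> [[r ? [<- _]]|pq] //; exists q => //; split=> //;
    by have [] := step_at pq.
  + move=> X e EX Xe p q; split=> [[r rp rq]|[-> qe]].
      by rewrite (step_inj rp rq); have [] := step_at rq.
    by have [r rq] := step_total qe; exists r.
  + by move=> X e f EX Xe Xf ef p q; split=> // -[r rp rq]; apply: ef;
      exact: step_sep EX Xe Xf rp rq.
- by [].
- by move=> u v _ IH p q; symmetry.
- by move=> u v w _ IH1 _ IH2 p q; rewrite IH1.
- move=> u u' v v' _ IHu _ IHv p q.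
  by split=> -[r /IHu pr /IHv rq]; exists r.
- by move=> u u' _ IH p q.
- move=> u v w p q; split=> [[r pr [r' ? ?]]|[r [r' ? ?] ?]].
    by exists r' => //; exists r.
  by exists r' => //; exists r.
- by move=> u p q; split=> // -[].
- by move=> u p q; split=> // -[].
- move=> u p q; have [uf ui] := act_partial_bij u.
  split=> [[r [r' pr' rr'] rq]|pq]; first by rewrite -(ui _ _ _ rr' rq).
  by exists p => //; exists q.
- move=> u p q; have [uf ui] := act_partial_bij u.
  split=> [[r [r' pr' rr'] rq]|pq].
    by rewrite (ui _ _ _ pr' rr').
  by exists p => //; exists q.
- move=> u v _ IHu _ IHv p q.
  have [uf ui] := act_partial_bij u; have [vf vi] := act_partial_bij v.
  split=> [pq|qp].
    have [r [r' pr' rr'] rq] := iffRL (IHv _ _) pq.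
    by rewrite (vi _ _ _ pq pr') (vf _ _ _ pq rq).
  have [r [r' pr' rr'] rq] := iffRL (IHu _ _) qp.
  by rewrite (ui _ _ _ qp pr') (uf _ _ _ qp rq).
Qed.

Lemma act_nonzero u (p q : M) : act u p q ->
  weval (@pres_gen _ (@sg_rel E)) u <> szero :> sg_semigroup E.
Proof.
rewrite weval_pi => pq /pres_piP uz.
by have /= := iffLR (act_sound uz p q) pq.
Qed.

End Soundness.

(** In the free system a point is a start vertex with a list of edges, and an edge
    is put in front of the list. Every vertex carries a point, so no vertex is
    zero in S(E,C). *)
Definition free_at (v : vertex E) (p : vertex E * seq (edge E)) := p.1 = v.
Definition free_step (e : edge E) (p q : vertex E * seq (edge E)) :=
  q.1 = rng e /\ p = (src e, e :: q.2).

Definition free_branching : branching.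
Proof.
apply: (@Branching _ free_at free_step).
- by move=> v w p <- <-.
- by move=> e p q [? ->].
- by move=> e p p' q [_ ->] [_ ->].
- by move=> e p [? ?] [? ?] [/= -> ->] [/= -> [->]].
- by move=> e q qe; exists (src e, e :: q.2).
- by move=> X e f p q q' _ _ _ [_ ->] [_ []].
Defined.

Lemma vgen_neq0 v : vgen (v : vertex E) <> szero.
Proof. by apply: (@act_nonzero free_branching (wV v) (v, [::]) (v, [::])). Qed.

Lemma vgen_inj v w (s : sg_semigroup E) : s <> szero ->
  mul (vgen v) s = s -> mul (vgen w) s = s -> v = w.
Proof.
move=> s0 vs ws; apply: contrapT => vw; apply: s0.
by rewrite -vs -ws mulgA (vgen_mul0 vw) mul0s.
Qed.

End Models.

(** * The action on nonzero elements by left multiplication *)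

Section Canonical.
Local Open Scope group_scope.
Variable E : separated_graph.
Implicit Types s y : sg_semigroup E.

Definition cayley_at (v : vertex E) s := s <> szero /\ vgen v * s = s.
Definition cayley_step (e : edge E) s t := cayley_at (rng e) t /\ s = egen (Fwd e) * t.

Lemma cayley_stepV e s t : cayley_step e s t -> egen (Bwd e) * s = t.
Proof. by move=> [[_ et] ->]; rewrite mulgA egenVe. Qed.

Definition cayley_branching : branching E.
Proof.
apply: (@Branching _ _ cayley_at cayley_step).
- by move=> v w s [s0 vs] [_ ws]; exact: vgen_inj s0 vs ws.
- move=> e s t st; split; last by case: st.
  have tE := cayley_stepV st; case: st => -[t0 _] sE; split.
    by move=> s0; apply: t0; rewrite -tE s0 muls0.
  by rewrite sE mulgA (egen_src (Fwd e)).
- by move=> e s s' t [_ ->] [_ ->].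
- by move=> e s t t' /cayley_stepV <- /cayley_stepV <-.
- by move=> e t et; exists (egen (Fwd e) * t).
- move=> X e f s t t' EX Xe Xf est fst; apply: contrapT => ef.
  have [[t0 _] _] := est; apply: t0; rewrite -(cayley_stepV est).
  by case: fst => _ ->; rewrite mulgA (egen_ef EX Xe Xf ef) mul0s.
Defined.

(** The word u is only defined at those s that pass every intermediate step, which
    is what the condition a^-1 a s = s expresses. *)
Lemma act_cayley (u : word (sg_gen E)) (s : cayley_branching) :
  let a : sg_semigroup E := weval (@pres_gen _ (@sg_rel E)) u in
  s <> szero -> sinv a * a * s = s -> act u (a * s : cayley_branching) s.
Proof.
elim: u s => [[v|[e|e]]||u IHu v IHv|u IHu] /= s s0.
- rewrite -/(vgen v) sinv_vgen vgen_idem => vs; by rewrite vs.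
- rewrite -/(egen (Fwd e)) sinv_Fwd egenVe => es; by split.
- rewrite -/(egen (Bwd e)) sinv_Bwd => es; split; last by rewrite mulgA.
  split; last by rewrite mulgA (egen_src (Bwd e)).
  by move=> h; apply: s0; rewrite -es -mulgA h muls0.
- by rewrite muls0 mul0s => h; case: s0.
- set a := weval _ u; set b := weval _ v; rewrite sinvM => abs.
  have bs : sinv b * b * s = s by rewrite -abs !mulgA mulVsV.
  have bs0 : b * s <> szero by move=> h; apply: s0; rewrite -bs -mulgA h muls0.
  exists (b * s); last exact: IHv.
  rewrite -mulgA; apply: IHu => //.
  have C := idem_comm (mulVs_idem a) (mulsV_idem b).
  transitivity (b * sinv b * (sinv a * a) * (b * s)).
    by rewrite -C -!mulgA (mulgA (sinv b) b) bs.
  by rewrite -[in RHS]abs !mulgA.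
- set a := weval _ u; rewrite sinvK => as_.
  have s1 : sinv a * s <> szero by move=> h; apply: s0; rewrite -as_ -mulgA h muls0.
  have s2 : a * (sinv a * s) = s by rewrite mulgA.
  have s3 : sinv a * a * (sinv a * s) = sinv a * s by rewrite -mulgA s2.
  by have := IHu _ s1 s3; rewrite /= s2.
Qed.

End Canonical.

(** * Redirecting one edge of a branching system *)

Section Glue.
Variables (E : separated_graph) (M N : branching E) (f : edge E) (p : M) (q : N).
Hypothesis pf : at_ (src f) p.
Hypothesis qf : at_ (rng f) q.
Hypothesis p_free : forall X g r, sep_all E X -> X f -> X g -> ~ step g p r.

Definition glue_at v (x : M + N) :=
  match x with inl a => at_ v a | inr b => at_ v b end.

(** The disjoint sum of M and N, except that f maps the point q of N to the point
    p of M. Injectivity and disjointness survive because p is not in the image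
    of any edge of the block of f. *)
Definition glue_step e (x y : M + N) :=
  match x, y with
  | inl a, inl b => step e a b
  | inr a, inr b => step e a b /\ ~ (e = f /\ b = q)
  | inl a, inr b => [/\ e = f, a = p & b = q]
  | inr _, inl _ => False
  end.

Lemma p_free_f r : ~ step f p r.
Proof.
by have [X fX Xf] := sep_block f; apply: (p_free _ Xf Xf); exists (src f).
Qed.

Definition glue : branching E.
Proof.
apply: (@Branching _ _ glue_at glue_step).
- by move=> v w [a|b]; exact: at_uniq.
- move=> e [a|a] [b|b] //=; first exact: step_at.
    by move=> [-> -> ->].
  by move=> [/step_at].
- move=> e [a|a] [a'|a'] [b|b] //=.
  + by move=> h /(step_fun h) ->.
  + by move=> [_ -> _] [_ -> _].
  + by move=> [-> _ ->] [_ []].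
  + by move=> [_ +] [? _ ?]; case.
  + by move=> [h _] [/(step_fun h) ->].
- move=> e [a|a] [b|b] [b'|b'] //=.
  + by move=> h /(step_inj h) ->.
  + by move=> + [eE aE _]; rewrite eE aE => /p_free_f.
  + by move=> [-> -> _] /p_free_f.
  + by move=> [_ _ ->] [_ _ ->].
  + by move=> [h _] [/(step_inj h) ->].
- move=> e [b|b] /= eb.
    by have [a ab] := step_total eb; exists (inl a).
  have [[eE bE]|nh] := pselect (e = f /\ b = q); first by exists (inl p).
  by have [a ab] := step_total eb; exists (inr a).
- move=> X e g [a|a] [b|b] [b'|b'] EX Xe Xg //=.
  + exact: step_sep EX Xe Xg.
  + by move=> h [gf aE _]; rewrite gf in Xg; rewrite aE in h; have := p_free EX Xg Xe h.
  + by move=> [ef aE _] h; rewrite ef in Xe; rewrite aE in h; have := p_free EX Xe Xg h.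
  + by move=> [-> _ _] [-> _ _].
  + by move=> [h _] [h' _]; exact: step_sep EX Xe Xg h h'.
Defined.

(** The redirection only affects points outside M, so what was defined on M stays
    defined, with the same value. *)
Lemma act_glue (u : word (sg_gen E)) (a b : M) :
  act u a b -> act u (inl a : glue) (inl b).
Proof.
elim: u a b => [[v|[e|e]]||u IHu v IHv|u IHu] //= a b.
- by move=> [->].
- by move=> [r /IHu ar /IHv rb]; exists (inl r).
- exact: IHu.
Qed.

Lemma act_glue_edge :
  act (WMul (wE (Fwd f)) (wE (Bwd f))) (inl p : glue) (inl p).
Proof. by exists (inr q). Qed.

End Glue.

Section MeetEdge.
Local Open Scope group_scope.
Variable E : separated_graph.

(** If y chooses no edge of the block X, it is compatible with every f in X: glue
    two copies of the left multiplication system along f so that the point y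
    enters the image of f. *)
Lemma edge_meet_neq0 (X : set (edge E)) (f : edge E) (y : sg_semigroup E) :
  sep_all E X -> X f -> y <> szero -> y * y = y -> vgen (src f) * y = y ->
  (forall g, X g -> y * (egen (Fwd g) * egen (Bwd g)) <> y) ->
  y * (egen (Fwd f) * egen (Bwd f)) <> szero.
Proof.
move=> EX Xf y0 yy fy yX.
have q_at : @at_ _ (cayley_branching E) (rng f) (vgen (rng f)).
  by split; [exact: vgen_neq0|exact: vgen_idem].
have p_free Y g r : sep_all E Y -> Y f -> Y g ->
    ~ @step _ (cayley_branching E) g y r.
  move=> EY Yf Yg; rewrite (sep_all_eq EY EX Yf Xf) in Yg => gyr.
  have := yX g Yg; apply; rewrite idem_comm //.
    by rewrite -mulgA (cayley_stepV gyr); case: gyr => _ ->.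
  by rewrite -sinv_Fwd mulsV_idem.
have p_at : @at_ _ (cayley_branching E) (src f) y by [].
have [u yE] := sg_word y.
have yact : act u (y : cayley_branching E) y.
  by have := @act_cayley _ u y y0; rewrite /= -yE (idem_sinv yy) !yy; apply.
have := @act_nonzero _ (glue p_at q_at p_free)
  (WMul u (WMul (wE (Fwd f)) (wE (Bwd f)))) (inl y) (inl y).
rewrite /= -yE; apply; exists (inl y); first exact: act_glue.
exact: (act_glue_edge p_at q_at p_free).
Qed.

End MeetEdge.

(** * Filters of a semilattice and their topology *)

Section Semilattice.
Context {d : Order.disp_t} (L : bMeetSemilatticeType d).
Implicit Types (F : set L) (x y : L).

(** Otherwise F and x would generate a proper filter, larger than F. *)
Lemma ultrafilter_separate F x : semilattice_ultrafilter F -> ~ F x ->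
  exists2 y, F y & (x `&` y)%O = \bot%O.
Proof.
move=> [[[z Fz] F0 Fup FI] Fmax] Fx; apply: contrapT => noy.
pose F' := [set w | exists2 y, F y & (x `&` y <= w)%O].
have FF' : F `<=` F' by move=> y Fy; exists y => //; exact: leIr.
have F'filter : semilattice_filter F'.
  split; first by exists z; exact: FF'.
  - by move=> [y Fy xy]; apply: noy; exists y => //; apply/eqP; rewrite -lex0.
  - by move=> u v [y Fy xy] uv; exists y => //; exact: le_trans uv.
  - move=> u v [y Fy yu] [y' Fy' yv]; exists (y `&` y')%O; first exact: FI.
    by rewrite lexI (le_trans _ yu) ?(le_trans _ yv) ?leI2 ?leIl ?leIr.
by apply: Fx; rewrite -(Fmax _ F'filter FF'); exists z => //; exact: leIl.
Qed.

(** Zorn's lemma. The empty set is admitted among the candidates because the union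
    of the empty chain is empty; it is not maximal, being contained in the
    principal filter of x. *)
Lemma ultrafilter_exists x : x <> \bot%O ->
  exists2 F : set L, semilattice_ultrafilter F & F x.
Proof.
move=> x0; pose P := [set F : set L | F = set0 \/ semilattice_filter F /\ F x].
have Pup : P [set y | (x <= y)%O].
  right; split; last exact: lexx.
  split; first by exists x => /=.
  - by move=> /=; rewrite lex0 => /eqP.
  - by move=> y z /= xy; exact: le_trans.
  - by move=> y z /= xy xz; rewrite lexI xy.
have [C CP Ctot|F [PF Fmax]] := @Zorn_bigcup L P.
  have [[F CF Fx]|noF] := pselect (exists2 F, C F & F x); last first.
    left; apply/seteqP; split=> // y [F CF Fy]; apply: noF; exists F => //.
    by case: (CP F CF) => [F0|[]//]; rewrite F0 in Fy.
  have Cfilter G y : C G -> G y -> semilattice_filter G.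
    by move=> CG Gy; case: (CP G CG) => [G0|[]//]; rewrite G0 in Gy.
  right; split; last by exists F.
  split; first by exists x, F.
  - by move=> [G CG G0]; have [_ + _ _] := Cfilter _ _ CG G0; apply.
  - move=> y z [G CG Gy] yz; exists G => //.
    by have [_ _ up _] := Cfilter _ _ CG Gy; exact: up yz.
  - move=> y z [G CG Gy] [H CH Hz].
    have [GH|HG] := Ctot G H CG CH.
      exists H => //; have [_ _ _ HI] := Cfilter _ _ CH Hz.
      by apply: HI => //; exact: GH.
    exists G => //; have [_ _ _ GI] := Cfilter _ _ CG Gy.
    by apply: GI => //; exact: HG.
have [F0|[Ff Fx]] := PF.
  case: (Fmax _ _ Pup); rewrite F0; split=> // h.
  by have /= := h x (lexx x).
exists F => //; split=> // F' F'f FF'.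
apply/seteqP; split=> //; apply: contrapT => nF'F.
by apply: (Fmax F') => //; right; split=> //; exact: FF'.
Qed.

(** The topology is that of pointwise convergence of characteristic functions with
    values in a discrete space: to converge is to agree eventually at each x. *)
Lemma filter_space_cvgP (U : set_system (filter_space L)) (xi : filter_space L) :
  Filter U ->
  U --> xi <-> forall x, \forall G \near U, set_val G x <-> set_val xi x.
Proof.
move=> FU; pose c : filter_space L -> {ptws L -> bool} := @filter_char d L.
have cvgE : U --> xi <-> c @ U --> c xi.
  split=> [Uxi|cU A].
    exact: cvg_trans (cvg_app c Uxi) (@initial_continuous _ _ _ xi).
  rewrite nbhsE => -[B [[C oC CB] Bxi]] BA.
  have UC : (c @ U) C.
    apply: cU; apply: open_nbhs_nbhs; split => //.
    by move: Bxi; rewrite -CB.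
  by apply: (@filterS _ U _ (c @^-1` C)) => //; rewrite CB.
have cP (G : filter_space L) x : (c G x = c xi x) <-> (set_val G x <-> set_val xi x).
  rewrite /c /filter_char; split=> [h|h].
    by split=> /mem_set Gx; apply: set_mem; [rewrite -h|rewrite h].
  by apply/idP/idP => /set_mem /h /mem_set.
rewrite cvgE; split=> [cU x|h].
  have /cU : nbhs (c xi) (proj x @^-1` [set c xi x]).
    by apply: proj_continuous; exact: discrete_set1.
  move=> cUx.
  by apply: (@filterS _ U _ (c @^-1` (proj x @^-1` [set c xi x]))) => // G /cP.
apply/cvg_sup => x A; rewrite nbhsE => -[B [[C oC CB] Bxi]] BA.
apply: (@filterS _ U _ _ (c @^-1` A) _ (h x)) => G /cP GE; apply: BA.
by rewrite -CB /= GE; move: Bxi; rewrite -CB.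
Qed.

Lemma near_filter_finite (xi : filter_space L) (D : set L) : finite_set D ->
  \forall G \near xi, forall x, D x -> (set_val G x <-> set_val xi x).
Proof.
move=> /finite_fsetP[s ->].
have near1 := iffLR (filter_space_cvgP xi (nbhs_filter xi)) cvg_refl.
have := @filter_bigI _ _ s (fun x => [set G : filter_space L |
  set_val G x <-> set_val xi x]) (nbhs xi) (nbhs_filter xi) (fun x _ => near1 x).
by apply: (@filterS _ _ (nbhs_filter xi)) => G Gs x xs; exact: Gs.
Qed.

End Semilattice.

(** * Ultrafilters of idempotents and the main theorem *)

Section Ultrafilters.
Local Open Scope group_scope.
Variable E : separated_graph.
Local Notation S := (sg_semigroup E).
Local Notation L := (idempotents S).
Implicit Types (t : S) (F : set L).

Lemma conj_meet0 t p q : p * p = p -> p * q = szero ->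
  t * p * sinv t * (t * q * sinv t) = szero.
Proof.
move=> pp pq.
have -> : t * p * sinv t * (t * q * sinv t) = t * (p * (sinv t * t)) * q * sinv t.
  by rewrite !mulgA.
by rewrite (idem_comm pp (mulVs_idem t)) !mulgA -(mulgA _ p) pq muls0 mul0s.
Qed.

(** Take f in X. If (t f)(t f)^-1 is not in F, some y in F below t t^-1 is
    orthogonal to it. The conjugate b = t^-1 y t is a nonzero idempotent
    orthogonal to f f^-1, so by edge_meet_neq0 it lies below some g g^-1 with
    g in X. Conjugating back, y lies below (t g)(t g)^-1. *)
Lemma ultrafilter_block F t v X :
  semilattice_ultrafilter F -> F (rproj t) -> t * vgen v = t -> sep v X ->
  exists2 f, X f & F (rproj (t * egen (Fwd f))).
Proof.
move=> UF Ft tv vX; have [[_ F0 Fup FI] _] := UF.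
have [_ _ /(_ X vX) [f Xf]] := sep_partition v.
have EX : sep_all E X by exists v.
have [Ff|nFf] := pselect (F (rproj (t * egen (Fwd f)))); first by exists f.
have [y0 Fy0 y0f] := ultrafilter_separate UF nFf.
have {Fy0} : F (y0 `&` rproj t)%O by exact: FI.
have {y0f} : (rproj (t * egen (Fwd f)) `&` (y0 `&` rproj t))%O = \bot%O.
  by rewrite meetA y0f meet0x.
have : ((y0 `&` rproj t)%O <= rproj t)%O by exact: leIr.
move: (y0 `&` rproj t)%O => {y0} y /idem_leP /= yt /(congr1 val) /= yf Fy.
set a := val y in yt yf; have aa : a * a = a := idem_mulss y.
have ta : t * sinv t * a = a by rewrite idem_comm ?mulsV_idem.
pose p g : S := egen (Fwd g) * egen (Bwd g).
have pp g : p g * p g = p g by rewrite /p -sinv_Fwd mulsV_idem.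
have pE g : t * egen (Fwd g) * sinv (t * egen (Fwd g)) = t * p g * sinv t.
  by rewrite sinvM sinv_Fwd /p !mulgA.
rewrite pE in yf.
pose b := sinv t * a * t.
have tbt : t * b * sinv t = a by rewrite /b !mulgA ta -mulgA.
have btt : b * (sinv t * t) = b by rewrite /b -!mulgA (mulgA t (sinv t)) mulsVs.
have a0 : a <> szero by move=> a0; apply: F0; rewrite (_ : \bot%O = y) //; exact: val_inj.
have b0 : b <> szero by move=> b0; apply: a0; rewrite -tbt b0 muls0 mul0s.
have bb : b * b = b.
  by rewrite /b !mulgA -(mulgA _ t) -(mulgA _ a (t * _)) yt -(mulgA _ a a) aa.
have fb : vgen (src f) * b = b.
  by rewrite (sep_src vX Xf) /b !mulgA -{1}(sinv_vgen v) -sinvM tv.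
have pdef g : p g = egen (Fwd g) * egen (Bwd g) by [].
have bdef : b = sinv t * a * t by [].
clearbody p b.
have [[g Xg bg]|nbg] := pselect (exists2 g, X g & b * p g = b).
  exists g => //; apply: Fup Fy _; apply/idem_leP; rewrite /= pE -/a.
  rewrite -{1}tbt -!mulgA (mulgA (sinv t)) (mulgA b) btt (mulgA b) bg.
  by rewrite mulgA tbt.
case: (@edge_meet_neq0 E X f b) => //.
  by move=> g Xg bg; apply: nbg; exists g; rewrite ?pdef.
rewrite -pdef (idem_comm bb (pp f)).
have -> : b = sinv t * t * b by rewrite bdef !mulgA mulVsV.
rewrite mulgA (idem_comm (pp f) (mulVs_idem t)) bdef.
have -> : sinv t * t * p f * (sinv t * a * t) =
    sinv t * (t * p f * sinv t * a) * t by rewrite !mulgA.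
by rewrite yf muls0 mul0s.
Qed.

(** Induction on s as a product of generators; finiteness of the block is used when
    the last generator is an edge e, to find one ultrafilter near xi that agrees
    with xi at s s^-1 and at (s f)(s f)^-1 for all f in the block of e. *)
Lemma closure_ultrafilter_maximal (xi : filter_space L) (F : set L) :
  finitely_separated E -> closure (ultrafilter_set L) xi ->
  semilattice_filter F -> set_val xi `<=` F -> F = set_val xi.
Proof.
move=> finE clxi [_ F0 Fup FI] xiF; apply/seteqP; split=> // x.
have [[y xiy] xi0 xiup _] : semilattice_filter (set_val xi) := set_valP xi.
have nz s : F (rproj s) -> s <> szero by move=> Fs /rproj0 sE; rewrite sE in Fs.
suff claim : forall s, is_product s -> F (rproj s) -> set_val xi (rproj s).
  by rewrite -(rprojV x); apply: claim; exact: is_productP.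
have disj s t : F (rproj s) -> F (rproj t) ->
    s * sinv s * (t * sinv t) <> szero.
  by move=> Fs Ft st; apply: F0; rewrite (_ : \bot%O = (rproj s `&` rproj t)%O);
    [exact: FI|exact: val_inj].
move=> r; elim=> {r} [/nz //|v Fv|s v _ IH Fs|s e _ IH Fs].
- have y0 : val y <> szero.
    by move=> h; apply: xi0; rewrite (_ : \bot%O = y) //; exact: val_inj.
  have [w wy] := sg_lvertex y0.
  have xiw : set_val xi (rproj (vgen w)).
    apply: (xiup y) => //; apply/idem_leP => /=.
    by rewrite sinv_vgen vgen_idem idem_comm ?wy // ?idem_mulss ?vgen_idem.
  have [<-//|vw] := pselect (w = v).
  have := disj _ _ (xiF _ xiw) Fv; rewrite !sinv_vgen !vgen_idem.
  by rewrite (vgen_mul0 vw).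
- have s0 : s <> szero by move=> h; apply: (nz _ Fs); rewrite h mul0s.
  have [w sw] := sg_rvertex s0.
  have wv : w = v.
    apply: contrapT => wv; apply: (nz _ Fs).
    by rewrite -sw -mulgA (vgen_mul0 wv) muls0.
  by rewrite -wv sw in Fs *; exact: IH.
- have s0 : s <> szero by move=> h; apply: (nz _ Fs); rewrite h mul0s.
  have [w sw] := sg_rvertex s0.
  have we : w = dsrc e.
    apply: contrapT => we; apply: (nz _ Fs).
    by rewrite -sw -mulgA -(egen_src e) (mulgA (vgen w)) (vgen_mul0 we) mul0s muls0.
  rewrite {w}we in sw.
  have {}IH : set_val xi (rproj s) by apply: IH; apply: Fup Fs _; exact: rproj_mul_le.
  case: e sw Fs => e /= se Fs.
    have [X eX Xe] := sep_block e.
    have EX : sep_all E X by exists (src e).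
    pose D : set L := rproj s |` [set rproj (s * egen (Fwd f)) | f in X].
    have finD : finite_set D.
      by rewrite finite_setU; split; [exact: finite_set1|exact/finite_image/finE].
    have [G [UG GD]] := clxi _ (near_filter_finite xi finD).
    have Gs : set_val G (rproj s) by apply/GD => //; left.
    have [f Xf Gf] := ultrafilter_block UG Gs se eX.
    have xif : set_val xi (rproj (s * egen (Fwd f))) by apply/GD => //; right; exists f.
    have [<-//|fe] := pselect (f = e).
    case: (disj _ _ (xiF _ xif) Fs); rewrite !sinvM !sinv_Fwd.
    have pp : egen (Fwd f) * egen (Bwd f) * (egen (Fwd f) * egen (Bwd f)) =
        egen (Fwd f) * egen (Bwd f) by rewrite -sinv_Fwd mulsV_idem.
    by have := conj_meet0 s pp (fwd_meet0 EX Xf Xe fe); rewrite !mulgA.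
  suff -> : rproj (s * egen (Bwd e)) = rproj s by [].
  apply: val_inj; rewrite /= sinvM sinv_Bwd -mulgA (mulgA (egen (Bwd e))) egenVe.
  by rewrite mulgA se.
Qed.

(** The limit along an ultrafilter U on edges that contains X but no finite subset
    of it: the limit contains no f f^-1 with f in X, since among the ultrafilters
    attached to edges of X only that of f contains f f^-1. *)
Lemma closed_finite_block (X : set (edge E)) :
  closed (ultrafilter_set L) -> sep_all E X -> finite_set X.
Proof.
move=> clU EX; apply: contrapT => Xinf.
have [v _ vX] := EX.
have ge0 e : rproj (egen (Fwd e)) <> \bot%O :> L.
  move=> /rproj0 h; apply: (@vgen_neq0 E (rng e)).
  by rewrite -egenVe h muls0.
(* sets containing all but finitely many edges of X *)
pose A := [set B : set (edge E) | finite_set (X `\` B)].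
have PA : ProperFilter A.
  split; first by rewrite /A /= setD0.
  split.
  - by rewrite /A /= setDT; exact: finite_set0.
  - by move=> B C; rewrite /A /= setDIr finite_setU.
  - by move=> B C BC; apply: sub_finite_set; exact: setDS.
have [U [UU AU]] := ultraFilterLemma PA.
have PU : ProperFilter U := @ultra_proper _ _ UU.
have /choice[eta etaP] e : exists F : filter_space L,
    semilattice_ultrafilter (set_val F) /\ set_val F (rproj (egen (Fwd e))).
  have [F UF Fe] := ultrafilter_exists (@ge0 e).
  by have [Ff _] := UF; exists (SigSub (mem_set Ff : F \in @filters _ L)).
pose xi0 : set L := [set x | U [set e | set_val (eta e) x]].
have ef e : semilattice_filter (set_val (eta e)) by case: (etaP e) => -[].
have xiv : xi0 (rproj (vgen v)).
  apply: (@filterS _ U _ X); last first.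
    by apply: AU; rewrite /A /= setDv; exact: finite_set0.
  move=> e Xe /=; have [_ ee] := etaP e; have [_ _ up _] := ef e.
  apply: up ee _; apply/idem_leP; rewrite /= sinv_vgen vgen_idem.
  rewrite (idem_comm (mulsV_idem _) (vgen_idem v)).
  by rewrite -(sep_src vX Xe) mulgA (egen_src (Fwd e)).
have xi0f : semilattice_filter xi0.
  split.
  - by exists (rproj (vgen v)).
  - move=> U0; apply: (@filter_not_empty _ U); apply: filterS U0 => e /=.
    by have [_ + _ _] := ef e.
  - move=> x y Ux xy; apply: filterS Ux => e /= ex.
    by have [_ _ up _] := ef e; exact: up ex xy.
  - move=> x y Ux Uy; apply: filterS (filterI Ux Uy) => e /= -[ex ey].
    by have [_ _ _] := ef e; apply.
pose xi : filter_space L := SigSub (mem_set xi0f : xi0 \in @filters _ L).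
have Uxi : eta @ U --> xi.
  apply/filter_space_cvgP => x.
  have [Ux|Ux] := in_ultra_setVsetC [set e | set_val (eta e) x] UU.
    by apply: (@filterS _ U _ _ _ _ Ux) => e.
  apply: (@filterS _ U _ _ _ _ Ux) => e /= ex; split=> // Ux'.
  case: (@filter_not_empty _ U); apply: filterS (filterI Ux Ux') => e' /=.
  by case.
have ultra : semilattice_ultrafilter xi0.
  apply: (@closed_cvg _ _ _ PU eta (ultrafilter_set L) clU _ xi Uxi).
  by apply: (@filterE _ U) => e; case: (etaP e).
have vv : vgen v * vgen v = vgen v by exact: vgen_idem.
have [f Xf] := ultrafilter_block ultra xiv vv vX.
rewrite -(sep_src vX Xf) (egen_src (Fwd f)) => Uf.
apply: (@filter_not_empty _ U).
have Uf' : U (~` [set f]).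
  apply: AU; rewrite /A /= setDE setCK; apply: sub_finite_set (finite_set1 f).
  by move=> ? [].
have UX : U X by apply: AU; rewrite /A /= setDv; exact: finite_set0.
apply: filterS (filterI UX (filterI Uf Uf')) => e [Xe [/= etaf fe]].
have [[[_ F0 _ FI] _] ee] := etaP e.
apply: F0; rewrite (_ : \bot%O = (rproj (egen (Fwd e)) `&` rproj (egen (Fwd f)))%O).
  exact: FI.
apply: val_inj; rewrite /= !sinv_Fwd (fwd_meet0 EX Xe Xf) //.
Qed.

End Ultrafilters.

Theorem corollary5p16 (E : separated_graph)
    (hE : forall v : vertex E, ~ isolated_vertex v) :
  closed (ultrafilter_set (idempotents (sg_semigroup E)))
    <-> finitely_separated E.
Proof.
split=> [clU X EX|finE xi clxi]; first exact: closed_finite_block EX.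
split; first exact: (set_valP xi).
by move=> F Ff xiF; exact: closure_ultrafilter_maximal finE clxi Ff xiF.
Qed.
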